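(* Let $d\ge 1$ and let $c$ be an integral $\mathbb{R}^d$-configuration with a non-trivial integral annihilator. Then there exist periodic functions $c_1, \ldots , c_m \colon \mathbb{R}^d\to\mathbb{Z}$ such that $$c = c_1 + \ldots + c_m.$$
   Context: An $\mathbb{R}^d$-configuration is a function $c\colon\mathbb{R}^d\to\mathbb{C}$ taking only finitely many values; a function is integral if all its values are integers. An $\mathbb{R}^d$-polynomial is a finitely supported function $f\colon\mathbb{R}^d\to\mathbb{C}$. The product of an $\mathbb{R}^d$-polynomial $f$ and a function $c\colon\mathbb{R}^d\to\mathbb{C}$ is $(fc)(\mathbf{u})=\sum_{\mathbf{v}\in\mathrm{supp}(f)} f(\mathbf{v})\,c(\mathbf{u}-\mathbf{v})$. An annihilator of $c$ is an $\mathbb{R}^d$-polynomial $f$ with $fc=0$; non-trivial means non-zero. A function $g$ on $\mathbb{R}^d$ is periodic if there is a non-zero $\mathbf{t}\in\mathbb{R}^d$ with $g(\mathbf{u}-\mathbf{t})=g(\mathbf{u})$ for all $\mathbf{u}\in\mathbb{R}^d$. The functions $c_1,\dots,c_m$ are not required to take only finitely many values. *)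

(* Defs.v *)
From mathcomp Require Import all_boot all_order all_algebra.
From mathcomp Require Import all_classical all_reals.
From mathcomp Require Import complex.

Set Implicit Arguments.
Unset Strict Implicit.
Unset Printing Implicit Defensive.

Import Order.TTheory GRing.Theory Num.Theory.
Local Open Scope classical_set_scope.
Local Open Scope ring_scope.
Local Open Scope complex_scope.

Section Configurations.
Context {R : realType} {d : nat}.
Implicit Types f c : 'rV[R]_d -> R[i].

Definition configuration c := finite_set (range c).

Definition fsupp f : set 'rV[R]_d := [set v | f v != 0].

Definition polynomial_fun f := finite_set (fsupp f).

Definition integral c := forall u, exists z : int, c u = z%:~R.

(* For a polynomial f the support is finite, so the finitely supported sum
   below is the full sum over the support of f. *)
Definition pmul f c : 'rV[R]_d -> R[i] :=
  fun u => \sum_(v \in fsupp f) f v * c (u - v).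

Definition annihilator f c :=
  polynomial_fun f /\ forall u, pmul f c u = 0.

Definition nontrivial f := exists v, f v <> 0.

Definition periodic (T : Type) (g : 'rV[R]_d -> T) :=
  exists2 t : 'rV[R]_d, t <> 0 & forall u, g (u - t) = g u.

End Configurations.

(* Main.v *)
(** If an integral f annihilates c then f(X^p) c = f(X)^p c = 0 modulo p for
    every prime p; as c is bounded, f(X^n) c = 0 for all n whose prime factors
    are large, in particular for all n = 1 + i r with a suitable r > 0.  Elimination
    among these equations (a Vandermonde argument) isolates one term of f and
    gives a product of difference operators X^w - 1, w <> 0, that annihilates c.
    Since c is bounded, factors with commensurable periods w can be merged, and
    for pairwise incommensurable periods c is split by solving difference
    equations (X^w - 1) g = h among t-periodic functions. *)

From HB Require Import structures.
Require Import Defs.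
From mathcomp Require Import all_boot all_order all_algebra.
From mathcomp Require Import all_classical all_reals.
From mathcomp Require Import complex finfield ring lra.

Set Implicit Arguments.
Unset Strict Implicit.
Unset Printing Implicit Defensive.

Import Order.TTheory GRing.Theory Num.Theory.
Local Open Scope ring_scope.
Local Open Scope complex_scope.

(** * Frobenius for group rings in characteristic p *)

Section Frobenius.

(** Binomial theorem for commuting operators, by Pascal's rule. *)
Lemma iter_addD_comm (W : zmodType) (A B : {additive W -> W})
    (AB : forall x, A (B x) = B (A x)) n x :
  iter n (fun y => A y + B y) x
  = \sum_(i < n.+1) (iter (n - i) A (iter i B x)) *+ 'C(n, i).
Proof.
have iterAB m y : iter m A (B y) = B (iter m A y).
  by elim: m => //= m ->; rewrite AB.
elim: n => [|n IHn]; first by rewrite big_ord_recl big_ord0 addr0.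
rewrite iterS {}IHn /= !raddf_sum /= big_ord_recl bin0 mulr1n subn0.
rewrite [X in _ + X]big_ord_recr /= subnn binn mulr1n.
rewrite [RHS]big_ord_recl bin0 mulr1n subn0 [in RHS]big_ord_recr /= subnn binn mulr1n.
rewrite -addrA; congr (_ + _); rewrite addrA; congr (_ + _).
rewrite -big_split; apply: eq_bigr => i _ /=.
rewrite /bump /= add1n binS mulrnDr !raddfMn subSS -iterAB -iterS; congr (_ + _).
by rewrite -iterS -subSn // subSS.
Qed.

Variables (V : zmodType) (K : comNzRingType) (I : Type).
Implicit Types (s : seq I) (a : I -> K) (v : I -> V) (g : V -> K).

(** Action of the group ring element with terms [a k] X^([v k]); listing the terms by [s] allows
    induction on their number. *)
Definition conv a v s g : V -> K := fun u => \sum_(k <- s) a k * g (u - v k).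

Fact conv_zmod_morphism a v s : zmod_morphism (conv a v s).
Proof.
move=> g h; apply: funext => u; rewrite /conv !fctE -sumrB.
by apply: eq_bigr => k _; rewrite -mulrBr.
Qed.

HB.instance Definition _ a v s :=
  GRing.isZmodMorphism.Build (V -> K) (V -> K) (conv a v s)
    (conv_zmod_morphism a v s).

Lemma conv_comm a v s1 s2 g :
  conv a v s1 (conv a v s2 g) = conv a v s2 (conv a v s1 g).
Proof.
apply: funext => u; rewrite /conv.
under eq_bigr do rewrite mulr_sumr.
rewrite exchange_big /=; apply: eq_bigr => k _.
rewrite mulr_sumr; apply: eq_bigr => j _.
by rewrite mulrCA addrAC.
Qed.

Lemma iter_conv1 a v k n g u :
  iter n (conv a v [:: k]) g u = a k ^+ n * g (u - v k *+ n).
Proof.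
elim: n u => [|n IHn] u; first by rewrite mul1r subr0.
by rewrite iterS /conv big_seq1 IHn mulrA exprS mulrS opprD addrA.
Qed.

(* The group ring of V over K has characteristic p, so its Frobenius is additive. *)
Lemma iter_conv_pchar p (pK : p \in [pchar K]) a v s g u :
  iter p (conv a v s) g u = \sum_(k <- s) a k ^+ p * g (u - v k *+ p).
Proof.
have p_pr := pcharf_prime pK; have p_gt0 := prime_gt0 p_pr.
elim: s u => [|k s IHs] u.
  by rewrite big_nil -(prednK p_gt0) iterS /conv big_nil.
have -> : conv a v (k :: s) = fun h => conv a v [:: k] h + conv a v s h.
  by apply: funext => h; apply: funext => w; rewrite /conv !fctE big_cons big_seq1.
rewrite iter_addD_comm; last by move=> x; exact: conv_comm.
case: p pK p_pr p_gt0 IHs => // p pK p_pr _ IHs.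
rewrite big_ord_recl big_ord_recr bin0 subn0 !mulr1n /=.
rewrite [bump 0 p]add1n subnn binn mulr1n -!iterS add0n.
rewrite [X in _ + (X + _)]big1 => [|i _]; last first.
  have /dvdnP [q ->] : (p.+1 %| 'C(p.+1, bump 0 i))%N.
    by apply: prime_dvd_bin => //; rewrite /bump /= add1n ltnS ltn_ord.
  by apply: funext => w; rewrite natmulfctE mulrnA (mulrn_pchar pK).
by rewrite add0r fctE iter_conv1 big_cons -IHs.
Qed.

End Frobenius.

(** * Dilating annihilators of bounded integer functions *)

Section Dilation.
Variables (V : zmodType) (I : Type).
Implicit Types (s : seq I) (a : I -> int) (v : I -> V) (g : V -> int).

(* By Frobenius, f(X^p) g = f(X)^p g = 0 modulo p, and f(X^p) g is smaller than
   p in absolute value, so it vanishes. *)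
Lemma dilate_prime a v s g C p : prime p ->
    (forall u, `|g u| <= C) -> \sum_(k <- s) `|a k| * C < p%:Z ->
    (forall u, \sum_(k <- s) a k * g (u - v k) = 0) ->
  forall u, \sum_(k <- s) a k * g (u - v k *+ p) = 0.
Proof.
move=> p_pr gC ltp fg0 u; set x := (X in X = 0).
have pF := pchar_Fp p_pr.
have dvd_p : (p %| x)%Z.
  rewrite (dvdz_pcharf pF); apply/eqP.
  pose aF k : 'F_p := (a k)%:~R; pose gF w : 'F_p := (g w)%:~R.
  have fg0F : conv aF v s gF = 0.
    apply: funext => w; rewrite /conv /aF /gF.
    under eq_bigr do rewrite -intrM.
    by rewrite -rmorph_sum fg0.
  have iter0 n : (0 < n)%N -> iter n (conv aF v s) gF = 0.
    case: n => // n _; rewrite iterSr fg0F.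
    by elim: n => //= n ->; rewrite raddf0.
  have := iter_conv_pchar pF aF v s gF u; rewrite iter0 ?prime_gt0 //.
  move=> /esym e0; rewrite rmorph_sum -[RHS]e0; apply: eq_bigr => k _ /=.
  (* Fermat: a^p = a in 'F_p, so Frobenius leaves the coefficients alone. *)
  by rewrite intrM; congr (_ * _); rewrite -[LHS]expf_card card_Fp.
have ltx : `|x| < p%:Z.
  apply: le_lt_trans (ler_norm_sum _ _ _) _; apply: le_lt_trans ltp.
  by apply: ler_sum => k _; rewrite normrM ler_wpM2l.
move: dvd_p ltx; rewrite dvdzE /= -abszE ltz_nat.
case: (posnP `|x|%N) => [/eqP|x_gt0]; first by rewrite absz_eq0 => /eqP.
by move=> /(dvdn_leq x_gt0); rewrite leqNgt => /negP.
Qed.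

(** The prime factors of [n] are applied one at a time; the size condition on p does not involve the
    vectors [v k], so it survives each dilation. *)
Lemma dilate a v s g C n : (0 < n)%N ->
    (forall u, `|g u| <= C) ->
    (forall p, prime p -> (p %| n)%N -> \sum_(k <- s) `|a k| * C < p%:Z) ->
    (forall u, \sum_(k <- s) a k * g (u - v k) = 0) ->
  forall u, \sum_(k <- s) a k * g (u - v k *+ n) = 0.
Proof.
move=> n_gt0 gC big_p fg0.
elim/ltn_ind: n n_gt0 big_p => n IHn n_gt0 big_p u.
have [n_gt1|n_le1] := ltnP 1 n; last first.
  by rewrite (_ : n = 1%N) ?fg0 //; apply/eqP; rewrite eqn_leq n_le1.
have p_pr := pdiv_prime n_gt1; have p_dvd := pdiv_dvd n.
have [q nE] := dvdnP p_dvd.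
have q_gt0 : (0 < q)%N by move: n_gt0; rewrite nE; case: (q).
have ltqn : (q < n)%N by rewrite [X in (_ < X)%N]nE ltn_Pmulr ?prime_gt1.
rewrite nE; under eq_bigr do rewrite mulrnA.
apply: (@dilate_prime a (fun k => v k *+ q) s g C) => //.
  exact: big_p.
apply: IHn => // p' p'_pr p'_dvd; apply: big_p => //.
by rewrite nE dvdn_mulr.
Qed.

Lemma dilate_progression a v s g C :
    (forall u, `|g u| <= C) ->
    (forall u, \sum_(k <- s) a k * g (u - v k) = 0) ->
  exists2 r, (0 < r)%N &
    forall i u, \sum_(k <- s) a k * g (u - v k *+ (1 + i * r)) = 0.
Proof.
(* With r = M!, a prime p <= M divides i * r and hence not 1 + i * r. *)
move=> gC fg0; pose M := absz (\sum_(k <- s) `|a k| * C).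
exists M`!; first exact: fact_gt0.
move=> i; apply: dilate gC _ fg0 => // p p_pr p_dvd.
apply: le_lt_trans (ler_norm _) _; rewrite -abszE ltz_nat ltnNge -/M.
apply/negP => leM; move: p_dvd.
rewrite dvdn_addl ?dvdn_mull ?dvdn_fact ?prime_gt0 // dvdn1 => /eqP p1.
by rewrite p1 in p_pr.
Qed.

End Dilation.

(** * Difference operators and elimination *)

Section Differences.
Variable V : zmodType.
Implicit Types (w : V) (ws : seq V) (g h : V -> int).

Definition diff w g : V -> int := fun u => g (u - w) - g u.

Definition diffs ws g := foldr diff g ws.

Definition bounded g := exists C, forall u, `|g u| <= C.

Lemma diff_eq0P w g : diff w g = 0 <-> forall u, g (u - w) = g u.
Proof.
split=> [g0 u|gw]; last by apply: funext => u; rewrite /diff gw subrr.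
by apply/eqP; rewrite -subr_eq0 -/(diff w g u) g0.
Qed.

Lemma diffC w1 w2 g : diff w1 (diff w2 g) = diff w2 (diff w1 g).
Proof.
by apply: funext => u; rewrite /diff [u - w2 - w1]addrAC; ring.
Qed.

Lemma diffs_diff ws w g : diffs ws (diff w g) = diff w (diffs ws g).
Proof. by elim: ws => //= x ws ->; rewrite diffC. Qed.

Lemma diffs_rem ws w g : w \in ws -> diffs ws g = diff w (diffs (rem w ws) g).
Proof.
elim: ws => //= x ws IHws; rewrite inE eq_sym.
by case: eqVneq => [-> //|_ /= wws]; rewrite IHws // diffC.
Qed.

Lemma diffs_conv_term ws (a : int) v g u :
  diffs ws (fun u => a * g (u - v)) u = a * diffs ws g (u - v).
Proof.
elim: ws u => //= w ws IHws u.
by rewrite /diff !IHws -mulrBr addrAC.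
Qed.

Lemma bounded_diffs ws g : bounded g -> bounded (diffs ws g).
Proof.
move=> [C gC]; elim: ws => [|w ws [D gD]] /=; first by exists C.
by exists (D + D) => u; apply: le_trans (ler_normB _ _) (lerD _ _).
Qed.

(** Along [w] such a function is affine, and a bounded affine function has slope zero. *)
Lemma bounded_diff_diff w g : bounded g -> diff w (diff w g) = 0 -> diff w g = 0.
Proof.
move=> [C gC] /diff_eq0P dg; apply: funext => u.
have lin n : g (u - w *+ n) = g u + diff w g u *+ n.
  have dn m : diff w g (u - w *+ m) = diff w g u.
    elim: m => [|m IHm]; first by rewrite subr0.
    by rewrite mulrSr opprD addrA dg.
  elim: n => [|n IHn]; first by rewrite subr0 addr0.
  rewrite [in RHS]mulrSr addrA -IHn -[in RHS](dn n) /diff.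
  by rewrite addrC subrK mulrSr opprD addrA.
apply/eqP/negPn/negP => x0.
(* A non-zero integer slope is at least 1 in absolute value, so [n] steps exceed the largest
   possible variation [C + C]. *)
pose n := absz (C + C + 1).
have hi : `|diff w g u| *+ n <= C + C.
  rewrite -normrMn -(addKr (g u) (diff w g u *+ n)) -lin addrC.
  by apply: le_trans (ler_normB _ _) (lerD _ _).
have lo : C + C + 1 <= `|diff w g u| *+ n.
  apply: le_trans (ler_norm _) _; rewrite -abszE -/n -mulr_natr natz ler_peMl //.
  by rewrite lez_nat absz_gt0.
by have := le_trans lo hi; rewrite gerDl.
Qed.

Lemma diff_mulrz w g (a : int) : diff w g = 0 -> diff (w *~ a) g = 0.
Proof.
move=> /diff_eq0P gw; apply/diff_eq0P.
have gwn (n : nat) u : g (u - w *+ n) = g u.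
  by elim: n => [|n IHn]; rewrite ?subr0 // mulrSr opprD addrA gw.
case: a => n u; first exact: gwn.
by rewrite NegzE mulrNz opprK -(gwn n.+1) addrK.
Qed.

(* Subtracting a shift of the i-th equation from the (i+1)-st one removes one term. *)
Lemma eliminate (I : Type) (s : seq I) (x : I -> V) (e : I -> V -> int)
    x0 (e0 : V -> int) :
    (forall i u, e0 (u - x0 *+ i) + \sum_(k <- s) e k (u - x k *+ i) = 0) ->
  diffs [seq x0 - x k | k <- s] e0 = 0.
Proof.
elim: s e e0 => [|j s IHs] e e0 sum0 /=.
  by apply: funext => u; have := sum0 0%N u; rewrite big_nil addr0 subr0.
(* Evaluating the later equation at [u + x j] aligns the [j] terms, which cancel; every other term
   keeps its form, with [e k] differenced along [x k - x j]. *)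
rewrite -diffs_diff; apply: (IHs (fun k => diff (x k - x j) (e k))) => i u.
have shift (y : V) : u - y *+ i - (y - x j) = u + x j - y *+ i.+1.
  by rewrite opprB addrACA mulrSr opprD.
under eq_bigr do rewrite /diff shift.
have shift_j : u + x j - x j *+ i.+1 = u - x j *+ i.
  by rewrite mulrS opprD addrA addrK.
have := sum0 i.+1 (u + x j); have := sum0 i u.
rewrite !big_cons /diff shift shift_j sumrB => hi hS.
by lra.
Qed.

(** * Difference equations and splitting along independent directions *)

Fact diff_zmod_morphism w : zmod_morphism (diff w).
Proof. by move=> g h; apply: funext => u; rewrite /diff !fctE; ring. Qed.

HB.instance Definition _ w :=
  GRing.isZmodMorphism.Build (V -> int) (V -> int) (diff w) (diff_zmod_morphism w).

(** Infinite order of [w] modulo the subgroup generated by [t]. *)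
Definition indep (w t : V) := forall a b : int, w *~ a = t *~ b -> a = 0.

Lemma int_antidifference (h : int -> int) :
  exists G : int -> int, forall a, G (a - 1) - G a = h a.
Proof.
(* Sums taken outwards from the normalisation G 0 = 0; [Negz n] is -(n+1), whence [n.+1] terms. *)
exists (fun a => match a with
  | Posz n => - \sum_(i < n) h i.+1
  | Negz n => \sum_(i < n.+1) h (- i%:Z) end).
case=> [[|n]|n].
- by rewrite sub0r /= big_ord1 big_ord0 subr0 oppr0.
- have -> : n.+1%:Z - 1 = n by rewrite intS addrC addKr.
  by rewrite [X in _ - - X]big_ord_recr /= opprK addKr.
- have -> : Negz n - 1 = Negz n.+1 by rewrite !NegzE [X in _ = - X]intS; ring.
  by rewrite [X in X - _]big_ord_recr /= NegzE addrAC subrr add0r.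
Qed.

(* Modulo t the vector w still has infinite order, so the equation can be solved
   by summation along each coset of the group generated by w and t. *)
Lemma solve_diff w t h : indep w t -> diff t h = 0 ->
  exists2 g, diff t g = 0 & diff w g = h.
Proof.
move=> wt ht.
(* Cosets of the subgroup generated by [w] and [t]: equal cosets are equal sets, so [xget] picks the
   same representative for all their points. *)
pose cls x : set V := fun y => exists a b : int, x - y = w *~ a + t *~ b.
pose rep x := xget 0 (cls x).
have clsD x (a b : int) : cls (x - (w *~ a + t *~ b)) = cls x.
  apply: funext => y; apply: propext; split=> -[a' [b' xy]].
    exists (a + a'), (b + b'); rewrite !mulrzDr addrACA -xy.
    by rewrite addrA addrCA subrr addr0.
  by exists (a' - a), (b' - b); rewrite !mulrzBr addrAC xy opprD addrACA.
have /choice[A /choice[B AB]] :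
    forall x, exists a b : int, x - rep x = w *~ a + t *~ b.
  move=> x; have : cls x (rep x); last by [].
  by apply: xgetPex; exists x, 0, 0; rewrite subrr !mulr0z addr0.
(* Independence determines the [w]-coordinate [A], whatever choice was made for [B]. *)
have AE x (a b : int) : A (x - (w *~ a + t *~ b)) = A x - a.
  set y := x - _; have yx : rep y = rep x by rewrite /rep clsD.
  apply/eqP; rewrite -subr_eq0; apply/eqP.
  apply: (wt _ (B x - b - B y)); rewrite !mulrzBr.
  have := AB y; rewrite yx /y addrAC AB opprD addrACA => xy.
  by apply/eqP; rewrite subr_eq addrAC eq_sym subr_eq addrC xy.
have /choice[F FE] : forall r, exists G : int -> int,
    forall a, G (a - 1) - G a = h (r + w *~ a).
  by move=> r; apply: (int_antidifference (fun a => h (r + w *~ a))).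
have stepE x (a b : int) : F (rep (x - (w *~ a + t *~ b))) (A (x - (w *~ a + t *~ b)))
    = F (rep x) (A x - a) by rewrite AE /rep clsD.
exists (fun x => F (rep x) (A x)).
  apply/diff_eq0P => x; have := stepE x 0 1.
  by rewrite mulr0z add0r mulr1z subr0.
apply: funext => x; have := stepE x 1 0.
rewrite /diff mulr0z addr0 mulr1z => ->.
(* As [h] is [t]-periodic, it ignores the component [t *~ B x]. *)
have /diff_eq0P <- := diff_mulrz (B x) ht.
rewrite FE; congr h; apply/eqP; rewrite eq_sym subr_eq -addrA -AB.
by rewrite addrC subrK.
Qed.

(** By induction [diff w g] splits into periodic pieces; each is [diff w] of a function with the
    same period, and [g] minus these functions is [w]-periodic. *)
Lemma decompose ws g : diffs ws g = 0 ->
    (forall x y, x \in ws -> y \in rem x ws -> indep x y) ->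
  exists2 cs : nat -> V -> int,
    forall i, (i < size ws)%N -> diff (nth 0 ws i) (cs i) = 0
    & g = \sum_(i < size ws) cs i.
Proof.
elim: ws g => [|w ws IHws] g gws wsI.
  by exists (fun=> 0) => //=; rewrite big_ord0.
have [||cs csP csE] := IHws (diff w g); first by rewrite diffs_diff.
  move=> x y xws yws; apply: wsI; first by rewrite inE xws orbT.
  by rewrite /=; case: eqP => // _; [apply: mem_rem yws | rewrite inE yws orbT].
have /choice[h hP] : forall i, exists h, (i < size ws)%N ->
    diff (nth 0 ws i) h = 0 /\ diff w h = cs i.
  move=> i; have [iws|] := ltnP i (size ws); last by exists 0.
  have [|h ht hw] := @solve_diff w (nth 0 ws i) (cs i) _ (csP i iws); last by exists h.
  by apply: wsI; rewrite /= ?inE eqxx // mem_nth.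
exists (fun i => if i is j.+1 then h j else g - \sum_(i < size ws) h i).
  case=> [_|i /hP[]//] /=.
  rewrite raddfB raddf_sum /= csE; apply/eqP; rewrite subr_eq0; apply/eqP.
  by apply: eq_bigr => i _; have [] := hP i (ltn_ord i).
by rewrite /= big_ord_recl /= subrK.
Qed.

(* Two dependent directions x, y have a common multiple w; a factor D_x D_y can
   be replaced by D_w D_w, hence, on bounded functions, by D_w alone. *)
Lemma reduce_dependent ws g :
    (forall (v : V) (a : int), v *~ a = 0 -> a = 0 \/ v = 0) ->
    bounded g -> 0 \notin ws -> diffs ws g = 0 ->
  exists ws', [/\ 0 \notin ws', diffs ws' g = 0
    & forall x y, x \in ws' -> y \in rem x ws' -> indep x y].
Proof.
move=> tf gB; have [n] := ubnP (size ws); elim: n ws => // n IHn ws wsn ws0 gws.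
have [wsI|] := pselect (forall x y, x \in ws -> y \in rem x ws -> indep x y).
  by exists ws.
move=> /existsNP[x] /existsNP[y] /not_implyP[xws] /not_implyP[yws].
move=> /existsNP[a] /existsNP[b] /not_implyP[xy] a0.
pose w := x *~ a; pose rest := rem y (rem x ws).
have x0 : x <> 0 by move=> x0; rewrite -x0 xws in ws0.
have restE : size ws = (size rest).+2.
  rewrite (size_rem yws) (size_rem xws).
  have : (0 < size (rem x ws))%N by case: (rem x ws) yws.
  by rewrite (size_rem xws); case: (size ws) => [|[]].
(* The common multiple [w] replaces both [x] and [y], so the list shrinks by one. *)
apply: (IHn (w :: rest)).
- by move: wsn; rewrite restE.
- rewrite inE negb_or eq_sym; apply/andP; split.
    by apply/eqP => /tf[].
  by apply: contra ws0 => /mem_rem /mem_rem.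
rewrite /=; apply: bounded_diff_diff; first exact: bounded_diffs.
rewrite [X in diff X _]xy; apply: diff_mulrz; rewrite diffC.
apply: diff_mulrz.
by rewrite -(diffs_rem _ yws) -(diffs_rem _ xws).
Qed.

End Differences.

(** * Bounded integer functions on a vector space *)

Section PeriodicDecomposition.
Variables (K : numFieldType) (V : lmodType K).

Lemma lmod_torsion_free (v : V) (a : int) : v *~ a = 0 -> a = 0 \/ v = 0.
Proof.
rewrite -scaler_int => /eqP; rewrite scaler_eq0 intr_eq0.
by case/orP => /eqP; [left | right].
Qed.

(** Dilation by 1 + i r turns the shift by v into v + i (r v): the fixed shift by v goes into the
    functions given to [eliminate], the rest is the [i]-th multiple of r v. *)
Lemma diffs_annihilator (s : seq V) (a g : V -> int) v0 :
    bounded g -> uniq s -> v0 \in s -> a v0 != 0 ->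
    (forall u, \sum_(v <- s) a v * g (u - v) = 0) ->
  exists2 ws, 0 \notin ws & diffs ws g = 0.
Proof.
move=> [C gC] s_uniq v0s a0 fg0.
have [r r0 fr0] := dilate_progression gC fg0.
exists [seq v0 *+ r - v *+ r | v <- rem v0 s].
  apply/mapP => -[v]; rewrite mem_rem_uniq // inE => /andP[vv0 _].
  move=> /esym/eqP; rewrite -mulrnBl -scaler_nat scaler_eq0 pnatr_eq0.
  by rewrite eqn0Ngt r0 subr_eq0 eq_sym (negPf vv0).
have /(congr1 (fun h : V -> int => h (_ + v0))) e0 :
    diffs [seq v0 *+ r - v *+ r | v <- rem v0 s] (fun u => a v0 * g (u - v0)) = 0.
  apply: (eliminate (e := fun v u => a v * g (u - v))) => i u.
  rewrite -[RHS](fr0 i u) (perm_big _ (perm_to_rem v0s)) big_cons.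
  have E v : u - v *+ r *+ i - v = u - v *+ (1 + i * r).
    by rewrite mulrnDr mulr1n mulnC mulrnA opprD addrA addrAC.
  by rewrite E; congr (_ + _); apply: eq_bigr => v _; rewrite E.
apply: funext => u; apply: (mulfI a0).
by have := e0 u; rewrite diffs_conv_term addrK mulr0.
Qed.

Lemma bounded_periodic_decomposition (s : seq V) (a g : V -> int) v0 :
    bounded g -> uniq s -> v0 \in s -> a v0 != 0 ->
    (forall u, \sum_(v <- s) a v * g (u - v) = 0) ->
  exists (ws : seq V) (cs : nat -> V -> int), [/\ 0 \notin ws,
    forall i, (i < size ws)%N -> diff (nth 0 ws i) (cs i) = 0
    & g = \sum_(i < size ws) cs i].
Proof.
move=> gB s_uniq v0s a0 fg0.
have [ws ws0 gws] := diffs_annihilator gB s_uniq v0s a0 fg0.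
have [ws' [ws'0 gws' wsI]] := reduce_dependent lmod_torsion_free gB ws0 gws.
have [cs csP gE] := decompose gws' wsI.
by exists ws', cs.
Qed.

End PeriodicDecomposition.

(** * From complex-valued configurations to integer functions *)

Theorem theorem6p15 (R : realType) (d : nat) (hd : (1 <= d)%N)
    (c : 'rV[R]_d -> R[i]) (c_conf : configuration c) (c_int : integral c)
    (c_ann : exists f : 'rV[R]_d -> R[i],
        [/\ annihilator f c, nontrivial f & integral f]) :
  exists (m : nat) (cs : 'I_m -> 'rV[R]_d -> int),
    [/\ (0 < m)%N,
        forall i, periodic (cs i)
      & forall u, c u = \sum_(i < m) (cs i u)%:~R].
Proof.
have [f [[f_fin fc0] [v0 /eqP fv0] f_int]] := c_ann.
(* The default 0 is never reached at values of [c] and [f], which are integers. *)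
pose toZ (x : R[i]) : int := xget 0 [set z | x = z%:~R]%classic.
have toZK (x : R[i]) : (exists z : int, x = z%:~R) -> (toZ x)%:~R = x.
  by move=> xz; have /esym := xgetPex 0 (P := [set z | x = z%:~R]%classic) xz.
have cZ u : (toZ (c u))%:~R = c u by exact: toZK.
have fZ v : (toZ (f v))%:~R = f v by exact: toZK.
have cB : bounded (toZ \o c).
  have /finite_seqP[s sE] := c_conf.
  exists (\sum_(x <- s) `|toZ x|) => u /=.
  have us : c u \in s.
    by have : range c (c u) by []; rewrite sE.
  by rewrite (big_rem _ us) /= lerDl sumr_ge0.
pose s : seq 'rV[R]_d := finmap.enum_fset (fset_set (fsupp f)).
have v0s : v0 \in s by rewrite in_fset_set // inE.
have [|||ws [cs [ws0 csP cE]]] :=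
    @bounded_periodic_decomposition R _ s (toZ \o f) (toZ \o c) v0 cB _ v0s.
- exact: finmap.fset_uniq.
- by rewrite -(intr_eq0 R[i]) fZ.
- move=> u; apply/eqP; rewrite -(intr_eq0 R[i]) rmorph_sum; apply/eqP.
  rewrite -[RHS](fc0 u) /pmul fsbig_finite //=; apply: eq_bigr => v _.
  by rewrite rmorphM /= fZ cZ.
have csE u : c u = \sum_(i < size ws) (cs i u)%:~R.
  by rewrite -cZ -[toZ _]/((toZ \o c) u) cE fct_sumE rmorph_sum.
case: (posnP (size ws)) => [ws_nil|ws_gt0]; last first.
  exists (size ws), cs; split=> // i.
  exists (nth 0 ws i); last exact/diff_eq0P/csP.
  by move=> w0; rewrite -w0 mem_nth in ws0.
(* An empty list of periods forces c = 0; one zero summand keeps m positive, and the all-ones vector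
   is a non-zero period since d >= 1. *)
exists 1%N, (fun _ _ => 0); split=> // [_|u].
  exists (const_mx 1) => // /rowP /(_ (Ordinal hd)) /eqP.
  by rewrite !mxE oner_eq0.
by rewrite big_ord1 csE ws_nil big_ord0.
Qed.
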